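(* For every integer $d\ge 1$, the degree of the Hilbert series of $R_{6,9,d}$ is equal to $3(d-1)$ and its leading coefficient is bounded from below by $d$.
   Context: Let $\Bbbk$ be a field of characteristic zero. $R_{6,9,d}=\Bbbk[x_1,\ldots,x_6]/(\ell_1^d,\ldots,\ell_9^d)$, where $\ell_1,\ldots,\ell_9$ are general linear forms, i.e. the statement holds for all $(\ell_1,\dots,\ell_9)$ in some nonempty Zariski open subset of the space of $9$-tuples of linear forms. The Hilbert series of a standard graded algebra $A$ is $\sum_i\dim_\Bbbk(A_i)t^i$; here it is a polynomial, and its leading coefficient is the coefficient in its top degree. *)

(* Defs.v *)
From mathcomp Require Import all_boot all_order all_algebra.
From mathcomp Require Import mpoly.

Set Implicit Arguments.
Unset Strict Implicit.
Unset Printing Implicit Defensive.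

Import GRing.Theory.
Local Open Scope ring_scope.

Section LinearForms.
Variables (k : fieldType) (n r : nat).

(* A point of the affine space 'M[k]_(r, n) is an r-tuple of linear forms in
   n variables, row j holding the coefficients of the j-th form. *)
Definition linform (L : 'M[k]_(r, n)) (j : 'I_r) : {mpoly k[n]} :=
  \sum_(i < n) L j i *: 'X_i.

Definition zariski_open (U : 'M[k]_(r, n) -> Prop) : Prop :=
  exists F : {mpoly k[r * n]} -> Prop,
    forall L, U L <->
      exists2 f, F f & f.@[fun i => mxvec L 0 i] != 0.

Definition power_ideal (d : nat) (L : 'M[k]_(r, n)) (p : {mpoly k[n]}) : Prop :=
  exists g : 'I_r -> {mpoly k[n]}, p = \sum_(j < r) g j * linform L j ^+ d.

End LinearForms.

Section HilbertSeries.
Variables (k : fieldType) (n : nat).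

(* The degree i component of k[x_1..x_n] / I is S_i / (S_i :&: I), where S_i is
   the space of forms of degree i; it has dimension m when some m forms of
   degree i are a basis of S_i modulo I. *)
Definition graded_quot_dim (I : {mpoly k[n]} -> Prop) (i m : nat) : Prop :=
  exists b : 'I_m -> {mpoly k[n]},
    (forall j, b j \is i.-homog) /\
    (forall p : {mpoly k[n]}, p \is i.-homog ->
       exists! c : 'rV[k]_m, I (p - \sum_(j < m) c 0 j *: b j)).

(* Only applicable when the Hilbert series of k[x_1..x_n] / I is a polynomial. *)
Definition is_hilbert_series (I : {mpoly k[n]} -> Prop) (H : {poly nat}) : Prop :=
  forall i : nat, graded_quot_dim I i (H`_i)%R.

End HilbertSeries.

(* Main.v *)
(* By apolarity, the degree D part of R vanishes iff no nonzero form of degree D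
   vanishes at the nine points dual to the l_j to order D + 1 - d.

   In degree 3d - 2 such forms are ruled out for general points with Cremona
   transformations: the substitution x_i -> 1/x_i turns a form F of degree D
   whose degree in x_i is at most a_i (that is, of multiplicity at least D - a_i
   at the i-th coordinate point) into one of degree a_1 + ... + a_6 - D, and
   preserves multiplicities at points with nonzero coordinates. More generally,
   consider forms of degree D vanishing at the j-th point to order
   D + 1 - s_j, where s_1 + ... + s_9 <= 3D + 6; this inequality is preserved,
   and basing the transformation at the six points with the smallest s_j lowers
   D, so that induction on D applies. That R is zero in degree 3d - 2 is an open
   condition on the l_j, so it suffices to find one instance.

   In degree 3d - 3, the cubics singular at nine points of P^5 form a space of
   dimension at least 56 - 54 = 2. If F, G are independent such cubics, then the
   d forms F^i G^(d-1-i) have degree 3(d-1) and vanish to order 2(d-1) at each of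
   the points, and they are linearly independent. *)

From HB Require Import structures.
Require Import Defs.
From mathcomp Require Import all_boot all_order all_algebra.
From mathcomp Require Import perm mpoly ring zify.

Import GRing.Theory.
Local Open Scope ring_scope.

Set Implicit Arguments.
Unset Strict Implicit.
Unset Printing Implicit Defensive.

(** * Nonvanishing points of polynomials *)

Lemma base_expansion_inj (b n : nat) (f g : nat -> nat) :
    (forall i, f i < b)%N -> (forall i, g i < b)%N ->
    (\sum_(i < n) f i * b ^ i = \sum_(i < n) g i * b ^ i)%N ->
  forall i, (i < n)%N -> f i = g i.
Proof.
elim: n f g => [//|n IHn] f g fb gb.
have b_gt0 : (0 < b)%N by apply: leq_ltn_trans (fb 0).
have shift (h : nat -> nat) : (\sum_(i < n.+1) h i * b ^ i =
                (\sum_(i < n) h i.+1 * b ^ i) * b + h 0)%N.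
  rewrite big_ord_recl expn0 muln1 addnC big_distrl; congr (_ + _)%N.
  by apply: eq_bigr => i _; rewrite /= expnSr mulnA.
rewrite !shift => eq_fg.
have eq0 : f 0 = g 0.
  by have := congr1 (modn^~ b) eq_fg; rewrite !modnMDl !modn_small.
move: eq_fg; rewrite eq0 => /addIn/eqP; rewrite eqn_pmul2r // => /eqP eq_fg.
case=> [//|i] lt_in.
by apply: (IHn (fun i => f i.+1) (fun i => g i.+1)).
Qed.

Section Char0Field.
Variable (k : fieldType).
Hypothesis k_char0 : [pchar k] =i pred0.

(** In characteristic zero the elements 0, ..., [size p - 1] are distinct, and too many for all of
    them to be roots. *)
Lemma poly_nonroot (p : {poly k}) : p != 0 -> exists x, p.[x] != 0.
Proof.
move=> p_neq0.
have [/allP p_roots|/allPn[x _ px]] :=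
  boolP (all (root p) [seq i%:R | i <- iota 0 (size p)]); last by exists x.
have := max_poly_roots p_neq0 (introT allP p_roots).
rewrite size_map size_iota ltnn map_inj_uniq ?iota_uniq; first by move=> /(_ isT).
have nat_inj (i j : nat) : (i <= j)%N -> i%:R = j%:R :> k -> i = j.
  move=> le_ij /eqP; rewrite eq_sym -subr_eq0 -natrB //.
  rewrite (pcharf0P k).1 // subn_eq0 => le_ji; apply/eqP; by rewrite eqn_leq le_ij.
move=> i j eq_ij; have [/nat_inj|/ltnW/nat_inj h] := leqP i j; first exact.
by apply/esym/h.
Qed.

(* Kronecker substitution 'X_i |-> 'X^(b^i), injective on monomials of degree
   less than b, reduces the claim to one variable. *)
Lemma mpoly_nonroot n (p : {mpoly k[n]}) :
  p != 0 -> exists v : 'I_n -> k, p.@[v] != 0.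
Proof.
move=> p_neq0; set b := msize p.
pose e (m : 'X_{1..n}) := (\sum_(i < n) m i * b ^ i)%N.
pose q : {poly k} := \sum_(m <- msupp p) p@_m *: 'X^(e m).
have q_neq0 : q != 0.
  apply/eqP => /(congr1 (fun q : {poly k} => q`_(e (mlead p)))).
  rewrite coef0 /q coef_sum (bigD1_seq (mlead p)) ?mlead_supp //=.
  rewrite coefZ coefXn eqxx mulr1 big_seq_cond big1 ?addr0.
    by apply/eqP; rewrite mleadc_eq0.
  move=> m /andP[m_supp m_neq]; rewrite coefZ coefXn; case: eqP; last by rewrite mulr0.
  have lt_b m' i : m' \in msupp p -> (m' i < b)%N.
    move=> /msize_mdeg_lt; apply: leq_ltn_trans; rewrite mdegE.
    by rewrite (bigD1 i) //= leq_addr.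
  (* Exponents are extended by 0 past the index range, to fit [base_expansion_inj]. *)
  pose digit (m' : 'X_{1..n}) i := oapp m' 0%N (insub i : option 'I_n).
  have digitE m' : e m' = (\sum_(i < n) digit m' i * b ^ i)%N.
    by apply: eq_bigr => i _; rewrite /digit valK.
  have digit_lt m' i : m' \in msupp p -> (digit m' i < b)%N.
    move=> m'_supp; rewrite /digit; case: insubP => [j _ _|_] /=; first exact: lt_b.
    by apply: leq_ltn_trans (msize_mdeg_lt m'_supp).
  rewrite !digitE => /esym/base_expansion_inj eq_digit; case/eqP: m_neq.
  apply/mnmP => i; have := eq_digit _ _ i (ltn_ord i); rewrite /digit valK /=.
  by apply=> j; apply: digit_lt; rewrite ?mlead_supp.
have [x qx] := poly_nonroot q_neq0; exists (fun i => x ^+ (b ^ i)).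
apply: contraNneq qx; rewrite mevalE /q horner_sum => px0.
apply/eqP; rewrite -[RHS]px0; apply: eq_bigr => m _.
rewrite hornerZ hornerXn; congr (_ * _); rewrite /e -prodrXr.
by apply: eq_bigr => i _; rewrite mulnC exprM.
Qed.

End Char0Field.

(** * Forms and the apolarity pairing *)

Section Monomials.
Variables (n d : nat).

(** Made a finite type below, so that monomials of degree d can index sums and matrices. *)
Record monom := Monom { mnm_of_monom :> 'X_{1..n}; _ : mdeg mnm_of_monom == d }.

HB.instance Definition _ := [isSub for mnm_of_monom].
HB.instance Definition _ := [Countable of monom by <:].

Lemma mdeg_monom (m : monom) : mdeg m = d.
Proof. by apply/eqP; case: m. Qed.

Definition bmnm_of_monom (m : monom) : 'X_{1..n < d.+1} :=
  BMultinom (eq_leq (congr1 succn (mdeg_monom m))).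

Definition monom_of_bmnm (m : 'X_{1..n < d.+1}) : option monom := insub (val m).

Lemma bmnm_of_monomK : pcancel bmnm_of_monom monom_of_bmnm.
Proof. by move=> m; rewrite /monom_of_bmnm /= valK. Qed.

HB.instance Definition _ : isFinite monom := PCanIsFinite bmnm_of_monomK.

(** Replaces the support, which depends on p, by a fixed index set. *)
Lemma sum_msupp_homog (R S : nzRingType) (p : {mpoly R[n]}) (E : 'X_{1..n} -> S) :
    p \is d.-homog -> (forall m, p@_m = 0 -> E m = 0) ->
  \sum_(m <- msupp p) E m = \sum_(m : monom) E m.
Proof.
move=> p_homog E0.
have msuppE : perm_eq (msupp p)
    [seq mnm_of_monom m | m <- index_enum (Finite.clone monom _) & mnm_of_monom m \in msupp p].
  apply: uniq_perm; first exact: msupp_uniq.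
  by rewrite (map_inj_uniq val_inj) filter_uniq // index_enum_uniq.
  move=> m; apply/idP/mapP => [m_supp|[m' m'_in ->]].
    have /eqP mdeg_m := dhomog_mf p_homog m_supp.
    by exists (Monom mdeg_m); rewrite // mem_filter m_supp mem_index_enum.
  by move: m'_in; rewrite mem_filter => /andP[].
rewrite (perm_big _ msuppE) big_map big_filter /=.
rewrite [RHS](bigID (fun m : monom => (m : 'X_{1..n}) \in msupp p)) /=.
by rewrite [X in _ + X]big1 ?addr0 // => m /memN_msupp_eq0/E0.
Qed.

Lemma mpoly_homogE (R : nzRingType) (p : {mpoly R[n]}) :
  p \is d.-homog -> p = \sum_(m : monom) p@_m *: 'X_[m].
Proof.
move=> p_homog; rewrite {1}[p]mpolyE (sum_msupp_homog (E := fun m => p@_m *: 'X_[m])) //.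
by move=> m ->; rewrite scale0r.
Qed.

Lemma mmap_homogE (R S : nzRingType) (f : {rmorphism R -> S}) (h : 'I_n -> S)
    (p : {mpoly R[n]}) :
  p \is d.-homog -> mmap f h p = \sum_(m : monom) f p@_m * mmap1 h m.
Proof.
move=> p_homog; rewrite /mmap (sum_msupp_homog (E := fun m => f p@_m * mmap1 h m)) //.
by move=> m ->; rewrite rmorph0 mul0r.
Qed.

Lemma mcoeff_sum_monom (R : nzRingType) (c : monom -> R) (m : monom) :
  (\sum_(m' : monom) c m' *: 'X_[m'])@_m = c m.
Proof.
rewrite raddf_sum (bigD1 m) //= mcoeffZ mcoeffX eqxx mulr1 big1 ?addr0 // => m' neq_m'm.
by rewrite mcoeffZ mcoeffX val_eqE (negPf neq_m'm) mulr0.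
Qed.

Lemma sum_monom_homog (R : nzRingType) (c : monom -> R) :
  \sum_(m : monom) c m *: 'X_[m] \is d.-homog.
Proof. by apply: rpred_sum => m _; rewrite rpredZ // dhomogX; apply/eqP/mdeg_monom. Qed.

Lemma homog_eq (R : nzRingType) (p q : {mpoly R[n]}) :
  p \is d.-homog -> q \is d.-homog -> (forall m : monom, p@_m = q@_m) -> p = q.
Proof.
move=> p_homog q_homog eq_pq; rewrite (mpoly_homogE p_homog) (mpoly_homogE q_homog).
by apply: eq_bigr => m _; rewrite eq_pq.
Qed.

End Monomials.

Lemma card_monom n d : #|{: monom n.+1 d}| = 'C(d + n, d).
Proof.
rewrite -size_basis cardE -(size_map val); apply: perm_size.
apply: uniq_perm; rewrite ?uniq_basis ?(map_inj_uniq val_inj) ?enum_uniq //.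
move=> m; rewrite -basis_cover; apply/mapP/idP => [[m' _ ->]|mdeg_m].
  exact/eqP/mdeg_monom.
by exists (Monom mdeg_m); rewrite // mem_enum.
Qed.

(** The scalar obtained by applying the differential operator X^m to the monomial X^m. *)
Definition mfact n (m : 'X_{1..n}) : nat := \prod_(i < n) (m i)`!.

Lemma mfactD1 n (m : 'X_{1..n}) (i : 'I_n) :
  mfact (m + U_(i)) = ((m i).+1 * mfact m)%N.
Proof.
rewrite /mfact (bigD1 i) //= [in RHS](bigD1 i) //= mnmDE mnm1E eqxx addn1 factS mulnA.
congr (_ * _)%N; apply: eq_bigr => j neq_ji.
by rewrite mnmDE mnm1E eq_sym (negPf neq_ji) addn0.
Qed.

Section Lin.
Variables (R : comNzRingType) (n : nat).
Implicit Types (v : 'I_n -> R) (P : {mpoly R[n]}).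

Definition lin v : {mpoly R[n]} := \sum_(i < n) v i *: 'X_i.

Lemma lin_homog v : lin v \is 1.-homog.
Proof. by apply: rpred_sum => i _; rewrite rpredZ // dhomogX /= mdeg1. Qed.

Lemma lin_exp_homog v d : lin v ^+ d \is d.-homog.
Proof. by rewrite -[d in d.-homog]mul1n; apply/dhomogMn/lin_homog. Qed.

Lemma lin_scaleD v w c : lin (fun i => v i + c * w i) = lin v + c *: lin w.
Proof.
rewrite /lin scaler_sumr -big_split; apply: eq_bigr => i _ /=.
by rewrite scalerDl scalerA.
Qed.

Lemma lin_sum r (c : 'I_r -> R) (w : 'I_r -> 'I_n -> R) :
  lin (fun j => \sum_(i < r) c i * w i j) = \sum_(i < r) c i *: lin (w i).
Proof.
rewrite /lin; under [RHS]eq_bigr do rewrite scaler_sumr.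
rewrite exchange_big; apply: eq_bigr => j _ /=.
by rewrite scaler_suml; apply: eq_bigr => i _; rewrite scalerA.
Qed.

Lemma mcoeff_MXU P (i : 'I_n) (m : 'X_{1..n}) :
  (P * 'X_i)@_m = if m i is _.+1 then P@_(m - U_(i)) else 0.
Proof.
case mi: (m i) => [|a]; last first.
  have le_Um : (U_(i) <= m)%MM by rewrite lep1mP mi.
  by rewrite -[in LHS](submK le_Um) addmC mcoeffMX.
rewrite mcoeffM big1 // => -[m1 m2] /= /eqP def_m.
rewrite mcoeffX; case: eqP; last by rewrite mulr0.
move=> eq_m2; have := congr1 (fun m : 'X_{1..n} => m i) def_m.
by rewrite mi -eq_m2 mnmDE mnm1E eqxx addn1.
Qed.

(** The multinomial theorem, cleared of denominators so as to hold without inverting factorials. *)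
Lemma mcoeff_lin_exp v d (m : 'X_{1..n}) : mdeg m = d ->
  (mfact m)%:R * (lin v ^+ d)@_m = d`!%:R * mmap1 v m.
Proof.
elim: d m => [|d IHd] m mdeg_m.
  have -> : m = 0%MM by apply/eqP; rewrite -mdeg_eq0 mdeg_m.
  by rewrite expr0 mcoeff1 eqxx mmap11 /mfact big1 // => i _; rewrite mnm0E.
rewrite exprSr mulr_sumr raddf_sum mulr_sumr /=.
(* The i-th summand is m i copies of one quantity, and the m i add up to d + 1. *)
rewrite (eq_bigr (fun i => (m i)%:R * (d`!%:R * mmap1 v m))) => [|i _]; last first.
  rewrite -scalerAr mcoeffZ mcoeff_MXU.
  case mi: (m i) => [|a]; first by rewrite !(mulr0, mul0r).
  have le_Um : (U_(i) <= m)%MM by rewrite lep1mP mi.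
  have def_m := submK le_Um; set m' := (m - U_(i))%MM in def_m *.
  have m'i : m' i = a by apply: succn_inj; rewrite -mi -def_m mnmDE mnm1E eqxx addn1.
  have mdeg_m' : mdeg m' = d.
    by apply: succn_inj; rewrite -mdeg_m -def_m mdegD mdeg1 addn1.
  rewrite -def_m mfactD1 m'i commr_mmap1_M; last by move=> *; apply: mulrC.
  have := IHd _ mdeg_m'; rewrite mmap1U natrM => IH.
  transitivity (a.+1%:R * v i * ((mfact m')%:R * (lin v ^+ d)@_m')); first by ring.
  by rewrite IH; ring.
by rewrite -mulr_suml -natr_sum -mdegE mdeg_m factS natrM mulrA.
Qed.

End Lin.

(* For forms P and F of degree d, apolar P F is the scalar P(d/dx) F; taking the
   coefficients of P in a k-algebra allows evaluating F at points over it. *)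
Section Pairing.
Variables (k R : comNzRingType) (f : {rmorphism k -> R}) (n d : nat).
Implicit Types (P : {mpoly R[n]}) (F : {mpoly k[n]}).

Definition apolar P F : R :=
  \sum_(m : monom n d) (mfact m)%:R * P@_m * f F@_m.

Lemma apolar_sum (I : Type) (s : seq I) (Q : pred I) (c : I -> R) (P : I -> {mpoly R[n]}) F :
  apolar (\sum_(i <- s | Q i) c i *: P i) F = \sum_(i <- s | Q i) c i * apolar (P i) F.
Proof.
rewrite /apolar; under [RHS]eq_bigr do rewrite mulr_sumr.
rewrite exchange_big; apply: eq_bigr => m _ /=.
rewrite raddf_sum /= mulr_sumr mulr_suml; apply: eq_bigr => i _.
by rewrite mcoeffZ; ring.
Qed.

Lemma apolar_X F (m : monom n d) : apolar 'X_[m] F = (mfact m)%:R * f F@_m.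
Proof.
rewrite /apolar (bigD1 m) //= mcoeffX eqxx mulr1 big1 ?addr0 // => m' neq_m'm.
by rewrite mcoeffX val_eqE eq_sym (negPf neq_m'm) mulr0 mul0r.
Qed.

Lemma apolar_homog_neq P F e : P \is e.-homog -> e != d -> apolar P F = 0.
Proof.
move=> P_homog neq_ed; apply: big1 => m _.
by rewrite (dhomog_nemf_coeff P_homog) ?mulr0 ?mul0r //= mdeg_monom eq_sym.
Qed.

(** By the multinomial theorem the weights m! cancel, so powers of linear forms act as point
    evaluations. *)
Lemma apolar_lin_exp v F : F \is d.-homog ->
  apolar (lin v ^+ d) F = d`!%:R * mmap f v F.
Proof.
move=> F_homog; rewrite (mmap_homogE _ _ F_homog) mulr_sumr; apply: eq_bigr => m _.
by rewrite mcoeff_lin_exp ?mdeg_monom //; ring.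
Qed.

(** For a form of degree d over a field of characteristic zero, this is multiplicity at least d + 1
    - s at p: see [apolar_to_mult] and [mult_apolar_to]. *)
Definition apolar_to s (p : 'I_n -> R) F :=
  forall m : 'X_{1..n}, (mdeg m + s)%N = d -> apolar (lin p ^+ s * 'X_[m]) F = 0.

Lemma apolar_to_mul s p F Q : apolar_to s p F -> apolar (lin p ^+ s * Q) F = 0.
Proof.
move=> F_p; rewrite [Q]mpolyE mulr_sumr.
under eq_bigr do rewrite -scalerAr.
rewrite apolar_sum big1_seq // => m _.
have [/F_p->|neq_d] := eqVneq (mdeg m + s)%N d; first by rewrite mulr0.
rewrite (@apolar_homog_neq _ _ (s + mdeg m)%N) ?mulr0 1?addnC //.
by rewrite addnC dhomogM ?lin_exp_homog // dhomogX.
Qed.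

End Pairing.

(** * Ideals generated by powers of linear forms *)

Section PowerMatrix.
Variables (R : comNzRingType) (n r d : nat) (s : 'I_r -> nat).

Definition coords (p : {mpoly R[n]}) : 'rV[R]_#|{: monom n d}| :=
  \row_j p@_(enum_val j : monom n d).

Lemma coords_sum (I : Type) (t : seq I) (Q : pred I) (c : I -> R) (p : I -> {mpoly R[n]}) :
  coords (\sum_(i <- t | Q i) c i *: p i) = \sum_(i <- t | Q i) c i *: coords (p i).
Proof.
apply/rowP => j; rewrite mxE raddf_sum summxE; apply: eq_bigr => i _.
by rewrite /= mcoeffZ !mxE.
Qed.

Lemma coords_homog_neq p e : p \is e.-homog -> e != d -> coords p = 0.
Proof.
move=> p_homog neq_ed; apply/rowP => j; rewrite !mxE.
by rewrite (dhomog_nemf_coeff p_homog) //= mdeg_monom eq_sym.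
Qed.

Lemma coords_inj p q :
  p \is d.-homog -> q \is d.-homog -> coords p = coords q -> p = q.
Proof.
move=> p_homog q_homog /rowP eq_pq; apply: (homog_eq p_homog q_homog) => m.
by have := eq_pq (enum_rank m); rewrite !mxE enum_rankK.
Qed.

Definition form_of (u : 'rV[R]_#|{: monom n d}|) : {mpoly R[n]} :=
  \sum_(m : monom n d) u 0 (enum_rank m) *: 'X_[m].

Lemma form_of_homog u : form_of u \is d.-homog.
Proof. exact: sum_monom_homog. Qed.

Lemma form_ofK u : coords (form_of u) = u.
Proof. by apply/rowP => j; rewrite mxE mcoeff_sum_monom enum_valK. Qed.

Definition power_gen (L : 'M[R]_(r, n)) (x : 'I_r * 'X_{1..n < d.+1}) : {mpoly R[n]} :=
  lin (L x.1) ^+ s x.1 * 'X_[x.2].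

Lemma power_gen_homog L x : power_gen L x \is (s x.1 + mdeg x.2).-homog.
Proof. by rewrite dhomogM ?lin_exp_homog // dhomogX. Qed.

(* The row space of this matrix is the degree d part of the ideal generated by
   the powers lin (L j) ^+ s j; generators of degree other than d yield zero rows. *)
Definition power_mx (L : 'M[R]_(r, n)) :
    'M[R]_(#|{: 'I_r * 'X_{1..n < d.+1}}|, #|{: monom n d}|) :=
  \matrix_(i, j) (coords (power_gen L (enum_val i)) 0 j).

Lemma row_power_mx L i : row i (power_mx L) = coords (power_gen L (enum_val i)).
Proof. by apply/rowP => j; rewrite !mxE. Qed.

Definition in_power_ideal (L : 'M[R]_(r, n)) (p : {mpoly R[n]}) : Prop :=
  exists g : 'I_r -> {mpoly R[n]}, p = \sum_(j < r) g j * lin (L j) ^+ s j.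

End PowerMatrix.

Section Duality.
Variables (k : fieldType) (n r d : nat) (s : 'I_r -> nat).
Implicit Types (L : 'M[k]_(r, n)) (p F : {mpoly k[n]}).

Lemma in_power_ideal_coords L p :
  in_power_ideal s L p -> (coords d p <= power_mx d s L)%MS.
Proof.
case=> g ->; have -> : \sum_(j < r) g j * lin (L j) ^+ s j =
    \sum_(j < r) 1 *: (g j * lin (L j) ^+ s j).
  by apply: eq_bigr => j _; rewrite scale1r.
rewrite coords_sum summx_sub // => j _; rewrite scale1r [g j]mpolyE mulr_suml.
under eq_bigr do rewrite -scalerAl.
rewrite coords_sum summx_sub // => m _; apply: scalemx_sub.
have [mdeg_m|mdeg_m] := ltnP (mdeg m) d.+1.
  have -> : coords d ('X_[m] * lin (L j) ^+ s j) =
      row (enum_rank (j, BMultinom mdeg_m)) (power_mx d s L).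
    by rewrite row_power_mx enum_rankK mulrC.
  exact: row_sub.
rewrite (@coords_homog_neq _ _ _ _ (mdeg m + s j)) ?sub0mx //.
  by rewrite dhomogM ?lin_exp_homog // dhomogX.
by rewrite neq_ltn [X in _ || X](leq_trans mdeg_m) ?leq_addr ?orbT.
Qed.

Lemma in_power_idealP L p : p \is d.-homog ->
  in_power_ideal s L p <-> (coords d p <= power_mx d s L)%MS.
Proof.
move=> p_homog; split=> [|/submxP[u coords_p]]; first exact: in_power_ideal_coords.
pose gen := @power_gen k n r d s L.
pose deg_ok (x : 'I_r * 'X_{1..n < d.+1}) := (s x.1 + mdeg x.2 == d)%N.
(* Generators of other degrees are dropped to keep q homogeneous; their rows are zero. *)
pose q := \sum_(x | deg_ok x) u 0 (enum_rank x) *: gen x.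
have q_homog : q \is d.-homog.
  apply: rpred_sum => x /eqP deg_x; rewrite rpredZ //.
  by have := power_gen_homog s L x; rewrite deg_x.
have eq_pq : p = q.
  apply: (coords_inj p_homog q_homog); rewrite coords_p mulmx_sum_row coords_sum.
  rewrite (reindex_onto (@enum_rank _) enum_val) => [|i _]; last exact: enum_valK.
  under eq_bigl do rewrite enum_rankK eqxx.
  rewrite (bigID deg_ok) /= addrC big1 ?add0r; last first.
    move=> x; rewrite row_power_mx enum_rankK => deg_x.
    by rewrite (coords_homog_neq (power_gen_homog _ _ _)) ?scaler0.
  by apply: eq_bigr => x _; rewrite row_power_mx enum_rankK.
exists (fun j => \sum_(m | deg_ok (j, m)) u 0 (enum_rank (j, m)) *: 'X_[m]).
transitivity (\sum_j \sum_(m | deg_ok (j, m)) u 0 (enum_rank (j, m)) *: gen (j, m)).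
  by rewrite eq_pq pair_big_dep; apply: eq_big => -[].
apply: eq_bigr => j _; rewrite mulr_suml; apply: eq_bigr => m _.
by rewrite -scalerAl mulrC.
Qed.

(** Equivalently, the quotient by the ideal is zero in degree d. *)
Definition powers_span L := forall p, p \is d.-homog -> in_power_ideal s L p.

Lemma powers_spanP L : powers_span L <-> row_full (power_mx d s L).
Proof.
split=> [span_L|full_L p p_homog]; last first.
  by apply/in_power_idealP => //; apply: submx_full.
rewrite -sub1mx; apply/row_subP => i; rewrite -[row i _]form_ofK.
by apply/in_power_idealP; [|apply: span_L]; apply: form_of_homog.
Qed.

Hypothesis k_char0 : [pchar k] =i pred0.

Lemma mfact_neq0 (m : 'X_{1..n}) : (mfact m)%:R != 0 :> k.
Proof.
rewrite (pcharf0P k).1 // -lt0n; apply: prodn_gt0 => i; exact: fact_gt0.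
Qed.

(** The pairing is perfect, as the weights m! are invertible; hence a proper subspace of the forms
    of degree d has a nonzero annihilator. *)
Lemma powers_span_dual L :
  powers_span L <->
  (forall F, F \is d.-homog -> (forall j, apolar_to idfun d (s j) (L j) F) -> F = 0).
Proof.
split=> [span_L F F_homog F_perp|no_F].
  apply: (homog_eq F_homog) => [|m]; first exact: dhomog0.
  rewrite mcoeff0.
  have [|g Xm] := span_L 'X_[m]; first by rewrite dhomogX; apply/eqP/mdeg_monom.
  have := apolar_X idfun F m; rewrite Xm.
  under eq_bigr do rewrite -[g _ * _]scale1r.
  rewrite apolar_sum big1 => [|j _].
    by move/esym/eqP; rewrite mulf_eq0 (negPf (mfact_neq0 m)) => /eqP.
  rewrite mul1r -[RHS](apolar_to_mul (g j) (F_perp j)).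
  by congr apolar; apply: mulrC.
apply/powers_spanP; rewrite /row_full -mxrank_tr -/(row_free _) -kermx_eq0.
apply/negPn/negP => /rowV0Pn[c /sub_kermxP c_ker c_neq0].
(* Division by m! turns the functional c on coordinates into pairing with a form. *)
pose F : {mpoly k[n]} := \sum_(m : monom n d) (c 0 (enum_rank m) / (mfact m)%:R) *: 'X_[m].
have apolarF P : apolar idfun d P F = (c *m (coords d P)^T) 0 0.
  rewrite mxE (reindex_onto (@enum_rank _) enum_val) => [|i _]; last exact: enum_valK.
  under eq_bigl do rewrite enum_rankK eqxx.
  apply: eq_bigr => m _; rewrite mcoeff_sum_monom !mxE enum_rankK /=.
  by field; apply: mfact_neq0.
have F0 : F = 0.
  apply: no_F => [|j m]; first exact: sum_monom_homog.
  have [mdeg_m mdeg_d|mdeg_m] := ltnP (mdeg m) d.+1; last lia.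
  rewrite apolarF.
  have /rowP/(_ (enum_rank (j, BMultinom mdeg_m))) := c_ker.
  rewrite !mxE => c_ker0; rewrite -[RHS]c_ker0; apply: eq_bigr => i _.
  by rewrite !mxE enum_rankK.
case/eqP: c_neq0; apply/rowP => j; rewrite mxE.
have := congr1 (mcoeff (enum_val j : monom n d)) F0; rewrite mcoeff_sum_monom mcoeff0 enum_valK.
by move/eqP; rewrite mulf_eq0 invr_eq0 (negPf (mfact_neq0 _)) orbF => /eqP.
Qed.

End Duality.

(** Every monomial of degree d + 1 is a variable times one of degree d. *)
Lemma powers_span_succ (k : fieldType) n r d (s : 'I_r -> nat) (L : 'M[k]_(r, n)) :
  powers_span d s L -> powers_span d.+1 s L.
Proof.
move=> span_L p p_homog; rewrite (mpoly_homogE p_homog).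
apply: (big_ind (in_power_ideal s L)).
- by exists (fun=> 0); rewrite big1 // => j _; rewrite mul0r.
- move=> _ _ [f ->] [g ->]; exists (fun j => f j + g j).
  by rewrite -big_split; apply: eq_bigr => j _; rewrite mulrDl.
move=> m _; have [i mi] : exists i, m i != 0%N.
  apply/existsP; apply: contraT => /existsPn m0; have := mdeg_monom m.
  by rewrite mdegE big1 // => i _; apply/eqP/negPn/m0.
have le_Um : (U_(i) <= m)%MM by rewrite lep1mP.
have [|g Xg] := span_L 'X_[m - U_(i)].
  rewrite dhomogX /=; have := mdeg_monom m; rewrite -{1}(submK le_Um) mdegD mdeg1.
  by rewrite addn1 => /succn_inj ->.
exists (fun j => p@_m *: 'X_i * g j).
rewrite -(submK le_Um) addmC mpolyXD Xg mulr_sumr scaler_sumr.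
by apply: eq_bigr => j _; rewrite -!scalerAl mulrA.
Qed.

Lemma power_idealE (k : fieldType) n r (L : 'M[k]_(r, n)) d p :
  power_ideal d L p = in_power_ideal (fun=> d) L p.
Proof. by []. Qed.

(** A basis of a complement of the degree d part of the ideal, read as forms, is a basis of the
    quotient. *)
Lemma power_ideal_quot_dim (k : fieldType) n r (L : 'M[k]_(r, n)) e d :
  graded_quot_dim (power_ideal e L) d
    (#|{: monom n d}| - \rank (power_mx d (fun=> e) L)).
Proof.
set A := power_mx _ _ _; rewrite -mxrank_compl.
pose B := row_base (A^C)%MS; exists (fun j => form_of (row j B)).
split=> [j|p p_homog]; first exact: form_of_homog.
have memE (c : 'rV_(\rank A^C)%MS) :
    power_ideal e L (p - \sum_j c 0 j *: form_of (row j B)) <->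
    (coords d p - c *m B <= A)%MS.
  rewrite power_idealE (in_power_idealP (d := d)); last first.
    rewrite rpredB // rpred_sum // => j _.
    by rewrite rpredZ // form_of_homog.
  suff -> : coords d (p - \sum_j c 0 j *: form_of (row j B)) = coords d p - c *m B by [].
  transitivity (coords d p - coords d (\sum_j c 0 j *: form_of (row j B))).
    by apply/rowP => i; rewrite !mxE mcoeffB.
  by rewrite coords_sum mulmx_sum_row; under eq_bigr do rewrite form_ofK.
have /sub_addsmxP[[u v] /= coords_p] : (coords d p <= A + A^C)%MS.
  by apply: submx_full; apply: addsmx_compl_full.
have /submxP[c c_def] : (v *m A^C <= B)%MS by rewrite eq_row_base submxMl.
exists c; split=> [|c' /memE c'_in].
  by apply/memE; rewrite coords_p c_def addrK submxMl.
(* Uniqueness: [(c - c') *m B] lies in both A and its complement, and B is row free. *)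
apply/eqP; rewrite -subr_eq0 -[_ == 0](mulmx_free_eq0 _ (row_base_free A^C%MS)) -/B.
rewrite -submx0 -(capmx_compl A) sub_capmx; apply/andP; split; last first.
  by rewrite (submx_trans (submxMl _ _)) // eq_row_base.
have -> : (c - c') *m B = (coords d p - c' *m B) - u *m A.
  by rewrite coords_p c_def mulmxBl; rewrite addrAC [u *m A + _]addrC addrK.
by rewrite addmx_sub // ?eqmx_opp ?submxMl.
Qed.

(** * Multiplicity at a point *)

Section Multiplicity.
Variables (k : fieldType) (n : nat).
Implicit Types (p v : 'I_n -> k) (w : 'I_n -> {poly k}) (F : {mpoly k[n]}).

Definition arc_at p w (i : 'I_n) : {poly k} := (p i)%:P + 'X * w i.

(* The direction w may itself depend on 'X, so that the condition can be pulled
   back along polynomial maps. *)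
Definition mult_at_least mu p F :=
  forall w, 'X^mu %| mmap polyC (arc_at p w) F.

Lemma mult_at_leastM mu nu p F G :
  mult_at_least mu p F -> mult_at_least nu p G -> mult_at_least (mu + nu) p (F * G).
Proof.
move=> F_p G_p w; rewrite rmorphM exprD.
by apply: dvdp_mul; [apply: F_p | apply: G_p].
Qed.

Lemma mult_at_leastX mu p F e :
  mult_at_least mu p F -> mult_at_least (mu * e) p (F ^+ e).
Proof. by move=> F_p w; rewrite rmorphXn exprM; apply/dvdp_exp2r/F_p. Qed.

Lemma lin_map_polyC p : lin (fun i => (p i)%:P) = map_mpoly polyC (lin p).
Proof.
by rewrite /lin raddf_sum; apply: eq_bigr => i _; rewrite /= map_mpolyZ map_mpolyX.
Qed.

Lemma apolar_polyC d (P F : {mpoly k[n]}) :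
  apolar polyC d (map_mpoly polyC P) F = (apolar idfun d P F)%:P.
Proof.
rewrite /apolar raddf_sum; apply: eq_bigr => m _ /=.
by rewrite mcoeff_map_mpoly !rmorphM rmorph_nat.
Qed.

Lemma apolar_to_polyC d s p F :
  apolar_to idfun d s p F -> apolar_to polyC d s (fun i => (p i)%:P) F.
Proof.
move=> F_p m /F_p Fpm; have := apolar_polyC d (lin p ^+ s * 'X_[m]) F.
by rewrite Fpm rmorphM rmorphXn /= map_mpolyX lin_map_polyC.
Qed.

(** Taylor expansion along the arc: evaluation is pairing with (lin p + X lin w)^d, expanded
    binomially. *)
Lemma mmap_arc d p w F : F \is d.-homog ->
  d`!%:R * mmap polyC (arc_at p w) F =
  \sum_(i < d.+1) ('X^i *+ 'C(d, i)) *
    apolar polyC d (lin (fun i => (p i)%:P) ^+ (d - i) * lin w ^+ i) F.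
Proof.
move=> F_homog; rewrite -(apolar_lin_exp polyC _ F_homog) /arc_at lin_scaleD exprDn.
rewrite -apolar_sum; congr apolar; apply: eq_bigr => i _.
by rewrite exprZn -scalerAr scalerMnl.
Qed.

Hypothesis k_char0 : [pchar k] =i pred0.

Lemma natr_neq0 e : (0 < e)%N -> e%:R != 0 :> k.
Proof. by rewrite (pcharf0P k).1 // lt0n. Qed.

Lemma dvdp_natr_mul e (P Q : {poly k}) : (0 < e)%N -> (P %| e%:R * Q) = (P %| Q).
Proof.
by move=> /natr_neq0 e_neq0; rewrite -polyC_natr mul_polyC dvdpZr.
Qed.

(** Each Taylor term either has a factor X^i with i >= d + 1 - s or pairs F with a multiple of (lin
    p)^s. *)
Lemma apolar_to_mult d s p F : F \is d.-homog ->
  apolar_to idfun d s p F -> mult_at_least (d.+1 - s) p F.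
Proof.
move=> F_homog /apolar_to_polyC F_p w.
rewrite -(dvdp_natr_mul _ _ (fact_gt0 d)) (mmap_arc _ _ F_homog).
apply: (big_rec (fun q => 'X^(d.+1 - s) %| q)) => [|i q _ dvd_q]; first exact: dvdp0.
rewrite dvdp_add //.
have [le_mu|lt_mu] := leqP (d.+1 - s) i.
  by rewrite -mulr_natr -mulrA dvdp_mulr ?dvdp_exp2l.
have le_s : (s <= d - i)%N by lia.
by rewrite -(subnKC le_s) exprD -mulrA (apolar_to_mul _ F_p) mulr0 dvdp0.
Qed.

(** Constant directions v suffice: the Taylor coefficient of X^e, with e = d - s, pairs F with (lin
    p)^s (lin v)^e, and a polynomial in v vanishing at all points is zero. *)
Lemma mult_apolar_to d s p F : F \is d.-homog ->
    (forall v, 'X^(d.+1 - s) %| mmap polyC (arc_at p (polyC \o v)) F) ->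
  apolar_to idfun d s p F.
Proof.
move=> F_homog F_p m mdeg_m; set e := mdeg m in mdeg_m *.
have lin_perp v : apolar idfun d (lin p ^+ s * lin v ^+ e) F = 0.
  have := F_p v; rewrite -(dvdp_natr_mul _ _ (fact_gt0 d)) (mmap_arc _ _ F_homog).
  case/dvdpP => q /(congr1 (fun q : {poly k} => q`_e)).
  rewrite coefMXn ifT; last by lia.
  rewrite coef_sum.
  have lt_e : (e < d.+1)%N by lia.
  have coefE i : (('X^i *+ 'C(d, i)) * apolar polyC d
      (lin (fun i => (p i)%:P) ^+ (d - i) * lin (polyC \o v) ^+ i) F)`_e =
      (apolar idfun d (lin p ^+ (d - i) * lin v ^+ i) F *+ 'C(d, i)) *+ (i == e).
    have -> : lin (polyC \o v) = map_mpoly polyC (lin v) by rewrite -lin_map_polyC.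
    rewrite lin_map_polyC -!rmorphXn -rmorphM apolar_polyC.
    rewrite coefMC coefMn coefXn eq_sym; case: eqP => _; last by rewrite mul0rn mul0r.
    by rewrite mulr1n mulr_natl.
  rewrite (bigD1 (Ordinal lt_e)) //= coefE eqxx big1 ?addr0 => [|i neq_ie].
    have -> : (d - e)%N = s by lia.
    move/eqP; rewrite mulr1n -mulr_natr mulf_eq0 (negPf (natr_neq0 _)) ?orbF.
      by move/eqP.
    by rewrite bin_gt0; lia.
  by rewrite coefE; move: neq_ie; rewrite -val_eqE /= => /negPf->.
pose c (m : monom n e) : k := apolar idfun d (lin p ^+ s * 'X_[m]) F.
(* The value of P at v is the pairing in [lin_perp]. *)
pose P : {mpoly k[n]} :=
  \sum_(m : monom n e) (e`!%:R / (mfact m)%:R * c m) *: 'X_[m].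
have P0 : P = 0.
  apply/eqP/negPn/negP => /(mpoly_nonroot k_char0)[v]; case/eqP.
  rewrite /P raddf_sum -[RHS](lin_perp v).
  rewrite (mpoly_homogE (lin_exp_homog v e)) mulr_sumr.
  under [in RHS]eq_bigr do rewrite -scalerAr.
  rewrite apolar_sum; apply: eq_bigr => m' _; rewrite /= mevalZ mevalX -/(c m').
  have := mcoeff_lin_exp v (mdeg_monom m'); rewrite /mmap1.
  set x := _@_ _; set y := \prod_i _ => xy.
  have -> : x = e`!%:R / (mfact m')%:R * y.
    rewrite mulrAC -xy mulrC mulKf //; exact: mfact_neq0.
  by ring.
have /(congr1 (mcoeff m)) := P0; rewrite mcoeff0 /P.
have := mcoeff_sum_monom (fun m : monom n e => e`!%:R / (mfact m)%:R * c m) (Monom (eqxx e)).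
move=> /= -> /eqP; rewrite !mulf_eq0 invr_eq0 (negPf (mfact_neq0 k_char0 _)).
by rewrite (negPf (natr_neq0 (fact_gt0 _))) => /eqP.
Qed.

End Multiplicity.

(** * Cremona transformations *)

Section CremonaMap.
Variables (R S : comNzRingType) (n : nat).
Implicit Types (F : {mpoly R[n]}) (a m : 'X_{1..n}).

(* The standard Cremona involution y |-> 1/y with denominators cleared. *)
Definition cremona_pt (T : comNzRingType) (y : 'I_n -> T) (i : 'I_n) : T :=
  \prod_(j < n | j != i) y j.

(* X^a F(1/X); meaningful when a bounds the degrees of F, as the subtraction
   a - m is truncated. *)
Definition cremona a F : {mpoly R[n]} := \sum_(m <- msupp F) F@_m *: 'X_[a - m].

Definition degs_le a F := forall m, m \in msupp F -> (m <= a)%MM.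

Lemma cremona_homog a d e F : mdeg a = (d + e)%N -> F \is d.-homog ->
  degs_le a F -> cremona a F \is e.-homog.
Proof.
move=> mdeg_a F_homog F_a; rewrite /cremona big_seq rpred_sum // => m m_supp.
rewrite rpredZ // dhomogX /=.
have := congr1 mdeg (submK (F_a _ m_supp)).
by rewrite mdegD mdeg_a (dhomog_mf F_homog m_supp) addnC => /addnI->.
Qed.

Lemma mcoeff_cremona a F m : degs_le a F -> m \in msupp F ->
  (cremona a F)@_(a - m) = F@_m.
Proof.
move=> F_a m_supp; rewrite raddf_sum (bigD1_seq m) //= mcoeffZ mcoeffX eqxx mulr1.
rewrite big_seq_cond big1 ?addr0 // => m' /andP[m'_supp neq_m'm].
rewrite mcoeffZ mcoeffX; case: eqP => [eq_m'm|_]; last by rewrite mulr0.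
have := submK (F_a _ m'_supp); rewrite eq_m'm -{2}(submK (F_a _ m_supp)).
by move/addmI => eq_mm'; rewrite eq_mm' eqxx in neq_m'm.
Qed.

Lemma cremona_eq0 a F : degs_le a F -> cremona a F = 0 -> F = 0.
Proof.
move=> F_a F'0; apply/mpolyP => m; rewrite mcoeff0.
apply/eqP; rewrite mcoeff_eq0; apply/negP => m_supp.
have := mcoeff_cremona F_a m_supp; rewrite F'0 mcoeff0 => /esym/eqP.
by rewrite mcoeff_eq0 m_supp.
Qed.

Lemma degs_le_cremona a F : degs_le a (cremona a F).
Proof.
move=> m; rewrite mcoeff_msupp; apply: contraNT => nle_ma.
rewrite raddf_sum big1 //= => m' _; rewrite mcoeffZ mcoeffX; case: eqP; rewrite ?mulr0 //.
by move=> def_m; case/negP: nle_ma; rewrite -def_m lem_subr.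
Qed.

(** As [cremona_pt y] is 1/y scaled by the product of the y_i, this is y^a F(1/y) = (cremona a F)(y)
    without denominators. *)
Lemma mmap_cremona (f : {rmorphism R -> S}) (y : 'I_n -> S) a d F :
    F \is d.-homog -> degs_le a F ->
  mmap f (cremona_pt y) F * mmap1 y a = (\prod_i y i) ^+ d * mmap f y (cremona a F).
Proof.
move=> F_homog F_a; rewrite [in RHS]raddf_sum mulr_suml mulr_sumr.
apply: eq_big_seq => m m_supp /=; rewrite mmapZ mmapX.
rewrite -{1}(submK (F_a _ m_supp)) commr_mmap1_M; last by move=> *; apply: mulrC.
have -> : (\prod_i y i) ^+ d = mmap1 (cremona_pt y) m * mmap1 y m.
  have mdeg_m : \sum_i m i = d by rewrite -mdegE (dhomog_mf F_homog m_supp).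
  rewrite -mdeg_m -prodrXr /mmap1 -big_split; apply: eq_bigr => i _ /=.
  by rewrite -exprMn /cremona_pt (bigD1 i) //= mulrC.
by ring.
Qed.

End CremonaMap.

Section CoordinatePoints.
Variables (k : fieldType) (n : nat).
Hypothesis k_char0 : [pchar k] =i pred0.
Implicit Types (F : {mpoly k[n]}) (i : 'I_n).

Lemma lin_eq (v w : 'I_n -> k) : v =1 w -> lin v = lin w.
Proof. by move=> eq_vw; apply: eq_bigr => i _; rewrite eq_vw. Qed.

Lemma lin_delta i : lin (fun j => (i == j)%:R) = 'X_i :> {mpoly k[n]}.
Proof.
rewrite /lin (bigD1 i) //= eqxx scale1r big1 ?addr0 // => j.
by rewrite eq_sym => /negPf->; rewrite scale0r.
Qed.

(** At a coordinate point the generators X_i^s X^m are monomials, so the pairing reads off single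
    coefficients of F. *)
Lemma apolar_to_delta d s i F : F \is d.-homog ->
  apolar_to idfun d s (fun j => (i == j)%:R) F <->
  (forall m, m \in msupp F -> (m i < s)%N).
Proof.
move=> F_homog; rewrite /apolar_to lin_delta mpolyXn; split=> F_i m.
  move=> m_supp; rewrite ltnNge; apply/negP => le_s.
  have le_m : (U_(i) *+ s <= m)%MM.
    apply/mnm_lepP => j; rewrite mulmnE mnm1E.
    by case: eqP => [<-|_]; rewrite ?mul1n ?mul0n.
  have def_m := submK le_m; have mdeg_m : mdeg m = d := dhomog_mf F_homog m_supp.
  have /F_i : (mdeg (m - U_(i) *+ s) + s)%N = d.
    by rewrite -mdeg_m -[in RHS]def_m mdegD mdegMn mdeg1 mul1n.
  rewrite -mpolyXD addmC def_m (apolar_X idfun F (Monom (introT eqP mdeg_m))) /=.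
  move/eqP; rewrite mulf_eq0 (negPf (mfact_neq0 k_char0 _)) /=.
  by rewrite mcoeff_eq0 m_supp.
move=> mdeg_m; rewrite -mpolyXD.
have mdeg_m' : mdeg (U_(i) *+ s + m) == d by rewrite mdegD mdegMn mdeg1 mul1n addnC mdeg_m.
rewrite (apolar_X idfun F (Monom mdeg_m')) /= memN_msupp_eq0 ?mulr0 //.
by apply/negP => /F_i; rewrite mnmDE mulmnE mnm1E eqxx mul1n; lia.
Qed.

End CoordinatePoints.

Section CremonaStep.
Variables (k : fieldType) (n e : nat).
Hypothesis k_char0 : [pchar k] =i pred0.

(** The Cremona map sends an arc through q to an arc through [cremona_pt q]. The extra factor in
    [mmap_cremona] is prime to X because no coordinate of q is zero. *)
Lemma mult_cremona mu (q : 'I_n -> k) (a : 'X_{1..n}) d (F : {mpoly k[n]}) :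
    F \is d.-homog -> degs_le a F -> (forall i, q i != 0) ->
  mult_at_least mu (cremona_pt q) F -> mult_at_least mu q (cremona a F).
Proof.
move=> F_homog F_a q_neq0 F_q w.
have arc0 i : (arc_at q w i).[0] = q i by rewrite /arc_at !hornerE ?(mul0r, addr0).
pose w' i := (cremona_pt (arc_at q w) i - (cremona_pt q i)%:P) %/ 'X.
have arcE : arc_at (cremona_pt q) w' =1 cremona_pt (arc_at q w).
  move=> i; rewrite /arc_at /w' mulrC divpK ?subrKC //.
  rewrite -['X]subr0 -polyC0 dvdp_XsubCl rootE !hornerE horner_prod.
  by rewrite subr_eq0; apply/eqP/eq_bigr => j _; rewrite arc0.
have coprX j : coprimep 'X^mu ((\prod_i arc_at q w i) ^+ j).
  apply/coprimep_expl/coprimep_expr; rewrite coprimep_sym -['X]subr0 -polyC0.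
  rewrite coprimep_XsubC rootE horner_prod prodf_seq_neq0.
  by apply/allP => i _; rewrite arc0 q_neq0.
rewrite -(Gauss_dvdpr _ (coprX d)) -(mmap_cremona _ _ F_homog F_a) dvdp_mulr //.
have -> : mmap polyC (cremona_pt (arc_at q w)) F = mmap polyC (arc_at (cremona_pt q) w') F.
  by apply: eq_bigr => m _; congr (_ * _); apply/esym/mmap1_eq.
exact: F_q.
Qed.

(** The coordinate points bound the degrees of a dual form F by a. Then [cremona a F] is a form of
    degree d' that is dual for s' and Q, hence zero, and so is F. *)
Lemma powers_span_cremona d d' (a : 'X_{1..n}) (s s' : 'I_(n + e) -> nat)
    (Q : 'M[k]_(e, n)) :
    mdeg a = (d + d')%N ->
    (forall i, s (lshift e i) = (a i).+1) ->
    (forall i, s' (lshift e i) = (a i).+1) ->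
    (forall j, s' (rshift n j) = (s (rshift n j) + d' - d)%N) ->
    (forall j i, Q j i != 0) ->
  powers_span d' s' (col_mx 1%:M Q) ->
  powers_span d s (col_mx 1%:M (\matrix_(j, i) cremona_pt (Q j) i)).
Proof.
move=> mdeg_a s_l s'_l s'_r Q_neq0 /(powers_span_dual _ _ k_char0) span_Q.
apply/(powers_span_dual _ _ k_char0) => F F_homog F_perp.
have linl (B : 'M[k]_(e, n)) i : lin (col_mx 1%:M B (lshift e i)) = lin (fun j => (i == j)%:R).
  by apply: lin_eq => j; rewrite col_mxEu !mxE.
have F_a : degs_le a F.
  move=> m m_supp; apply/mnm_lepP => i; rewrite -ltnS -s_l.
  apply: (apolar_to_delta k_char0 _ _ F_homog).1 m_supp.
  by have := F_perp (lshift e i); rewrite /apolar_to linl.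
have F'_homog := cremona_homog mdeg_a F_homog F_a.
apply: (cremona_eq0 F_a); apply: span_Q => // j.
have [{}j ->|{}j ->] := split_ordP j.
  rewrite /apolar_to linl s'_l; apply/(apolar_to_delta k_char0 _ _ F'_homog) => m.
  by move/degs_le_cremona/mnm_lepP/(_ j).
have linr : lin (col_mx 1%:M Q (rshift n j)) = lin (Q j).
  by apply: lin_eq => i; rewrite col_mxEd.
rewrite /apolar_to linr; apply: mult_apolar_to => // v.
apply: (@dvdp_trans _ 'X^(d.+1 - s (rshift n j))).
  (* Here d' + 1 - s' <= d + 1 - s, with equality unless the subtraction defining s' truncates. *)
  by rewrite dvdp_exp2l // s'_r; lia.
apply: (mult_cremona F_homog F_a); first exact: Q_neq0.
apply: apolar_to_mult => //.
have := F_perp (rshift n j); rewrite /apolar_to.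
suff -> : lin (col_mx 1%:M (\matrix_(j, i) cremona_pt (Q j) i) (rshift n j)) =
  lin (cremona_pt (Q j)) by [].
by apply: lin_eq => i; rewrite col_mxEd mxE.
Qed.

End CremonaStep.

(** * Changes of coordinates and genericity *)

Section Equivariance.
Variables (k : fieldType) (n r d : nat).
Implicit Types (L : 'M[k]_(r, n)) (p : {mpoly k[n]}) (g h : 'M[k]_n).

Definition lin_subst g p : {mpoly k[n]} := mmap (@mpolyC n k) (fun i => lin (g i)) p.

Lemma lin_substM g : {morph lin_subst g : p q / p * q}.
Proof. by move=> p q; rewrite /lin_subst rmorphM. Qed.

Lemma lin_subst_lin g (v : 'rV[k]_n) : lin_subst g (lin (v 0)) = lin ((v *m g) 0).
Proof.
rewrite /lin_subst [LHS]raddf_sum.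
under eq_bigr do rewrite /= mmapZ mmapX mmap1U mul_mpolyC.
by rewrite -lin_sum; apply: lin_eq => j; rewrite mxE.
Qed.

Lemma lin_subst_comp g h p : lin_subst h (lin_subst g p) = lin_subst (g *m h) p.
Proof.
rewrite /lin_subst [mmap _ _ p in LHS]/mmap raddf_sum; apply: eq_bigr => m _.
rewrite /= rmorphM /= mmapC rmorph_prod; congr (_ * _).
apply: eq_bigr => i _; rewrite rmorphXn; congr (_ ^+ _).
have -> : lin (g i) = lin ((row i g) 0) by apply: lin_eq => j; rewrite mxE.
rewrite [LHS](lin_subst_lin h (row i g)); apply: lin_eq => j.
by rewrite -row_mul mxE.
Qed.

Lemma lin_subst1 p : lin_subst 1%:M p = p.
Proof.
rewrite [RHS]mpolyE; apply: eq_bigr => m _; rewrite mul_mpolyC -mmap1_id.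
congr (_ *: _); apply: mmap1_eq => i; rewrite -lin_delta.
by apply: lin_eq => j; rewrite mxE.
Qed.

Lemma lin_subst_homog g e p : p \is e.-homog -> lin_subst g p \is e.-homog.
Proof.
move=> p_homog; rewrite /lin_subst (mmap_homogE _ _ p_homog) rpred_sum // => m _.
rewrite mul_mpolyC rpredZ //; move: (mdeg_monom m); move: (m : 'X_{1..n}) => {}m <-.
rewrite mdegE; apply: (big_rec2 (fun (q : {mpoly k[n]}) e' => q \is e'.-homog)).
  exact: dhomog1.
move=> i q e' _ q_homog.
by rewrite dhomogM ?lin_exp_homog.
Qed.

(** Substitute the inverse of g in p, write the result in the ideal of L, and substitute g back. *)
Lemma powers_span_mulmx (s : 'I_r -> nat) L g : g \in unitmx ->
  powers_span d s L -> powers_span d s (L *m g).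
Proof.
move=> g_unit span_L p p_homog.
have [c pE] := span_L _ (lin_subst_homog (invmx g) p_homog).
exists (fun j => lin_subst g (c j)).
rewrite -[LHS]lin_subst1 -(mulVmx g_unit) -lin_subst_comp pE.
rewrite [LHS]raddf_sum; apply: eq_bigr => j _ /=.
rewrite -/(lin_subst g _) lin_substM; congr (_ * _).
rewrite /lin_subst rmorphXn; congr (_ ^+ _).
have -> : lin (L j) = lin ((row j L) 0) by apply: lin_eq => i; rewrite mxE.
rewrite [LHS](lin_subst_lin g (row j L)); apply: lin_eq => i.
by rewrite -row_mul mxE.
Qed.

Lemma powers_span_row_perm (s : 'I_r -> nat) (t : 'S_r) L :
  powers_span d (s \o t) L -> powers_span d s (row_perm t^-1 L).
Proof.
move=> span_L p /span_L[c ->]; exists (fun j => c (t^-1 j)%g).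
rewrite (reindex_inj (@perm_inj _ t^-1)) /=; apply: eq_bigr => j _.
rewrite permKV; congr (_ * _ ^+ _).
by apply: lin_eq => i; rewrite mxE.
Qed.

End Equivariance.

Section Genericity.
Variables (k : fieldType).

Lemma map_power_mx (R S : comNzRingType) (f : {rmorphism R -> S}) n r d s (L : 'M[R]_(r, n)) :
  map_mx f (power_mx d s L) = power_mx d s (map_mx f L).
Proof.
have map_lin (v : 'I_n -> R) : map_mpoly f (lin v) = lin (f \o v).
  by rewrite raddf_sum; apply: eq_bigr => i _; rewrite /= map_mpolyZ map_mpolyX.
apply/matrixP => i j; rewrite !mxE -mcoeff_map_mpoly; congr _@__.
rewrite rmorphM rmorphXn /= map_mpolyX map_lin; congr (_ ^+ _ * _).
by apply: eq_bigr => i' _; rewrite /= mxE.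
Qed.

Definition generic_mx r n : 'M[{mpoly k[r * n]}]_(r, n) :=
  \matrix_(i, j) 'X_(mxvec_index i j).

Lemma map_generic_mx r n (L : 'M[k]_(r, n)) :
  map_mx (meval (fun i => mxvec L 0 i)) (generic_mx r n) = L.
Proof. by apply/matrixP => i j; rewrite !mxE mevalXU mxvecE. Qed.

Lemma map_mx_mpolyC r n N (v : 'I_N -> k) (B : 'M[k]_(r, n)) :
  map_mx (meval v) (map_mx (@mpolyC N k) B) = B.
Proof. by apply/matrixP => i j; rewrite !mxE mevalC. Qed.

(** If B is a left inverse of the matrix at L0, then det (B * power_mx L) is a polynomial in L that
    is 1 at L0, and where it is nonzero the rank is full. *)
Lemma powers_span_open n r d s (L0 : 'M[k]_(r, n)) : powers_span d s L0 ->
  exists2 f : {mpoly k[r * n]}, f.@[fun i => mxvec L0 0 i] != 0 &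
    forall L, f.@[fun i => mxvec L 0 i] != 0 -> powers_span d s L.
Proof.
move=> /powers_spanP/row_fullP[B BL0].
pose f := \det (map_mx (@mpolyC (r * n) k) B *m power_mx d s (generic_mx r n)).
have fE L : f.@[fun i => mxvec L 0 i] = \det (B *m power_mx d s L).
  by rewrite -det_map_mx map_mxM map_mx_mpolyC map_power_mx map_generic_mx.
exists f => [|L]; rewrite fE; first by rewrite BL0 det1 oner_neq0.
rewrite -unitfE -unitmxE => BL_unit; apply/powers_spanP/row_fullP.
by exists (invmx (B *m power_mx d s L) *m B); rewrite -mulmxA mulVmx.
Qed.

Hypothesis k_char0 : [pchar k] =i pred0.

(** A general L has an invertible top block; taking its rows as coordinates keeps the span and makes
    the other points Q. *)
Lemma powers_span_normal n e d s (L0 : 'M[k]_(n + e, n)) : powers_span d s L0 ->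
  exists2 Q : 'M[k]_(e, n), forall i j, Q i j != 0 &
    powers_span d s (col_mx 1%:M Q).
Proof.
move=> /powers_span_open[f f_L0 f_open].
pose G := generic_mx (n + e) n.
(* The adjugate replaces the inverse, so that h is a polynomial. *)
pose h := \det (usubmx G) * \prod_i \prod_j (dsubmx G *m \adj (usubmx G)) i j.
have hE L : h.@[fun i => mxvec L 0 i] =
    \det (usubmx L) * \prod_i \prod_j (dsubmx L *m \adj (usubmx L)) i j.
  have eG := map_generic_mx L; rewrite rmorphM /= -det_map_mx map_usubmx eG.
  congr (_ * _); rewrite rmorph_prod; apply: eq_bigr => i _.
  rewrite rmorph_prod; apply: eq_bigr => j _.
  have -> : dsubmx L *m \adj (usubmx L) =
      map_mx (meval (fun i => mxvec L 0 i)) (dsubmx G *m \adj (usubmx G)).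
    by rewrite map_mxM map_mx_adj map_usubmx map_dsubmx eG.
  by rewrite [RHS]mxE.
have f_neq0 : f != 0 by apply: contraNneq f_L0 => ->; rewrite meval0.
have h_neq0 : h != 0.
  have := hE (col_mx 1%:M (const_mx 1)).
  rewrite col_mxKu col_mxKd det1 adj1 mulmx1 mul1r.
  rewrite big1 => [|i _]; last by rewrite big1 // => j _; rewrite mxE.
  by apply: contra_eqN => /eqP->; rewrite meval0 eq_sym oner_neq0.
have [v] := mpoly_nonroot k_char0 (mulf_neq0 f_neq0 h_neq0).
pose L : 'M_(n + e, n) := vec_mx (\row_i v i).
have vE p : p.@[v] = p.@[fun i => mxvec L 0 i].
  by apply: meval_eq => i; rewrite vec_mxK mxE.
rewrite mevalM mulf_eq0 negb_or !vE => /andP[/f_open span_L].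
rewrite hE mulf_eq0 negb_or => /andP[det_neq0 prod_neq0].
have U_unit : usubmx L \in unitmx by rewrite unitmxE unitfE.
exists (dsubmx L *m invmx (usubmx L)) => [i j|].
  rewrite /invmx U_unit -scalemxAr mxE mulf_neq0 ?invr_eq0 //.
  by move/prodf_neq0/(_ i isT)/prodf_neq0/(_ j isT): prod_neq0.
rewrite -(mulmxV U_unit) -mul_col_mx vsubmxK.
by apply: powers_span_mulmx => //; rewrite unitmx_inv.
Qed.

Lemma powers_span_exp0 n r d s (L : 'M[k]_(r, n)) j : s j = 0%N -> powers_span d s L.
Proof.
move=> sj p _; exists (fun i => if i == j then p else 0).
rewrite (bigD1 j) //= eqxx sj expr0 mulr1 big1 ?addr0 // => i /negPf->.
by rewrite mul0r.
Qed.

(** The coordinate points alone bound the degree of a nonzero dual form by mdeg a < d. *)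
Lemma powers_span_coords n e d s (a : 'X_{1..n}) (Q : 'M[k]_(e, n)) :
    (forall i, s (lshift e i) = (a i).+1) -> (mdeg a < d)%N ->
  powers_span d s (col_mx 1%:M Q).
Proof.
move=> s_l lt_ad; apply/(powers_span_dual _ _ k_char0) => F F_homog F_perp.
apply/mpolyP => m; rewrite mcoeff0; apply/eqP; rewrite mcoeff_eq0; apply/negP => m_supp.
move: lt_ad; rewrite -(dhomog_mf F_homog m_supp) /= !mdegE ltnNge; case/negP.
apply: leq_sum => i _; rewrite -ltnS -s_l.
apply: (apolar_to_delta k_char0 _ _ F_homog).1 m_supp.
have := F_perp (lshift e i); rewrite /apolar_to.
by suff -> : lin (col_mx 1%:M Q (lshift e i)) = lin (fun j => (i == j)%:R) by [];
  apply: lin_eq => j; rewrite col_mxEu mxE.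
Qed.

Lemma exists_cremona n e d d' (a : 'X_{1..n}) (s s' : 'I_(n + e) -> nat) :
    mdeg a = (d + d')%N ->
    (forall i, s (lshift e i) = (a i).+1) ->
    (forall i, s' (lshift e i) = (a i).+1) ->
    (forall j, s' (rshift n j) = (s (rshift n j) + d' - d)%N) ->
  (exists L : 'M[k]_(n + e, n), powers_span d' s' L) ->
  exists L : 'M[k]_(n + e, n), powers_span d s L.
Proof.
move=> mdeg_a s_l s'_l s'_r [L0 /powers_span_normal[Q Q_neq0 span_Q]].
by eexists; apply: (powers_span_cremona k_char0 mdeg_a s_l s'_l s'_r Q_neq0 span_Q).
Qed.

End Genericity.

(** * Vanishing in degree 3d - 2 *)

Lemma sorting_perm r (s : 'I_r -> nat) :
  exists t : 'S_r, forall i j : 'I_r, (i <= j)%N -> (s (t i) <= s (t j))%N.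
Proof.
have /tuple_permP[t sortE] : perm_eq (sort leq [tuple s i | i < r]) [tuple s i | i < r].
  by rewrite perm_sort.
exists t => i j le_ij.
have sorted_s := sort_sorted leq_total [tuple s i | i < r].
have nthE (i' : 'I_r) : nth 0%N (sort leq [tuple s i | i < r]) i' = s (t i').
  by rewrite sortE -tnth_nth !tnth_mktuple.
rewrite -!nthE; apply: (sorted_leq_nth leq_trans leqnn) => //.
  by rewrite inE size_sort size_tuple.
by rewrite inE size_sort size_tuple.
Qed.

(* Each Cremona transformation based at the six points with the smallest
   exponents strictly decreases the degree d. *)
Lemma exists_powers_span (k : fieldType) (k_char0 : [pchar k] =i pred0)
    d (s : 'I_(6 + 3) -> nat) :
    (exists j, s j = 0%N) \/ (\sum_j s j <= 3 * d + 6)%N ->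
  exists L : 'M[k]_(6 + 3, 6), powers_span d s L.
Proof.
elim/ltn_ind: d s => d IHd s.
have [/existsP[j /eqP sj _]|/existsPn s_neq0] := boolP [exists j, s j == 0%N].
  by exists 0; apply: (@powers_span_exp0 _ _ _ _ _ _ j).
case=> [[j sj]|sum_s]; first by have := s_neq0 j; rewrite sj.
have [t sorted_u] := sorting_perm s; pose u := s \o t.
suff [L span_L] : exists L : 'M[k]_(6 + 3, 6), powers_span d u L.
  by exists (row_perm t^-1 L); apply: powers_span_row_perm.
have u_gt0 i : (0 < u i)%N by rewrite lt0n s_neq0.
pose A := (\sum_(i < 6) u (lshift 3 i))%N; pose B := (\sum_(j < 3) u (rshift 6 j))%N.
have sum_u : (A + B <= 3 * d + 6)%N.
  have <- : (\sum_i u i = A + B)%N by rewrite big_split_ord.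
  by rewrite (reindex_inj (@perm_inj _ t)) in sum_s.
(* By sorting, the seventh exponent c satisfies A <= 6c and 3c <= B. *)
have leA2B : (A <= 2 * B)%N.
  pose c := u (rshift 6 (ord0 : 'I_3)).
  have : (A <= \sum_(i < 6) c)%N.
    by apply: leq_sum => i _; apply: sorted_u => /=; have := ltn_ord i; lia.
  have : (\sum_(j < 3) c <= B)%N by apply: leq_sum => i _; apply: sorted_u => /=; lia.
  by rewrite !sum_nat_const !card_ord; lia.
pose a := [multinom (u (lshift 3 i)).-1 | i < 6].
have mdeg_a : (mdeg a + 6 = A)%N.
  transitivity (mdeg a + \sum_(i < 6) 1)%N; first by rewrite sum_nat_const card_ord.
  rewrite mdegE -big_split; apply: eq_bigr => i _ /=.
  by rewrite mnmE addn1 prednK.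
have u_l i : u (lshift 3 i) = (a i).+1 by rewrite mnmE prednK.
have [lt_ad|le_da] := ltnP (mdeg a) d.
  by exists (col_mx 1%:M 0); apply: (powers_span_coords k_char0 0 u_l).
pose d' := (mdeg a - d)%N.
pose u' i := match split i with
             | inl i => u (lshift 3 i)
             | inr j => (u (rshift 6 j) + d' - d)%N
             end.
have u'_l i : u' (lshift 3 i) = u (lshift 3 i) by rewrite /u' (unsplitK (inl i)).
have u'_r j : u' (rshift 6 j) = (u (rshift 6 j) + d' - d)%N.
  by rewrite /u' (unsplitK (inr j)).
apply: (exists_cremona k_char0 (d' := d') (s' := u') _ u_l) => //.
- by rewrite /d' subnKC.
- by move=> i; rewrite u'_l.
(* From A <= 2B and A + B <= 3d + 6 follows A <= 2d + 4, so d' = A - 6 - d <= d - 2. *)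
apply: IHd; first by rewrite /d'; lia.
(* If no new exponent is 0, no subtraction was truncated, and both sides of the inequality change by
   3(d' - d). *)
have [/existsP[j /eqP u'j]|/existsPn u'_neq0] := boolP [exists j, u' j == 0%N].
  by left; exists j.
right; rewrite big_split_ord /=; under eq_bigr do rewrite u'_l.
pose C := (\sum_(j < 3) u' (rshift 6 j))%N; rewrite -/A -/C.
have : (C + \sum_(j < 3) d = B + \sum_(j < 3) d')%N.
  rewrite -!big_split; apply: eq_bigr => j _ /=.
  by have := u'_neq0 (rshift 6 j); rewrite u'_r; lia.
by rewrite !sum_nat_const !card_ord; clearbody A B C; lia.
Qed.

(** * Lower bound in degree 3d - 3 *)

Section LowerBound.
Variables (k : fieldType).
Hypothesis k_char0 : [pchar k] =i pred0.

Definition free_pair n (F G : {mpoly k[n]}) :=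
  forall a b, a *: F + b *: G = 0 -> a = 0 /\ b = 0.

Lemma apolarE n d (P F : {mpoly k[n]}) :
  apolar idfun d P F =
  \sum_j (mfact (enum_val j : monom n d))%:R * coords d P 0 j * coords d F 0 j.
Proof.
rewrite /apolar (reindex_onto (@enum_val _ _) enum_rank) => [|i _]; last exact: enum_rankK.
under eq_bigl do rewrite enum_valK eqxx.
by apply: eq_bigr => j _; rewrite !mxE.
Qed.

(** The kernel of #|I| linear conditions on a space of dimension at least #|I| + 2 has dimension at
    least 2. *)
Lemma exists_apolar_pair n d (I : finType) (P : I -> {mpoly k[n]}) :
    (#|I| + 2 <= #|{: monom n d}|)%N ->
  exists F G : {mpoly k[n]},
    [/\ F \is d.-homog, G \is d.-homog, free_pair F G,
        forall i, apolar idfun d (P i) F = 0 & forall i, apolar idfun d (P i) G = 0].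
Proof.
move=> le_card; set N := #|{: monom n d}| in le_card.
pose M : 'M[k]_(N, #|I|) :=
  \matrix_(j, i) ((mfact (enum_val j : monom n d))%:R * coords d (P (enum_val i)) 0 j).
pose B := row_base (kermx M).
have rank_ge2 : (1 < \rank (kermx M))%N.
  by rewrite mxrank_ker; have := rank_leq_col M; lia.
have formP (i : 'I_(\rank (kermx M))) x : apolar idfun d (P x) (form_of (row i B)) = 0.
  have /row_subP/(_ i)/sub_kermxP/rowP/(_ (enum_rank x)) : (B <= kermx M)%MS.
    by rewrite eq_row_base.
  rewrite !mxE => BM0; rewrite apolarE -[RHS]BM0; apply: eq_bigr => j _.
  by rewrite form_ofK !mxE enum_rankK mulrC.
pose i0 : 'I_(\rank (kermx M)) := Ordinal (ltnW rank_ge2).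
pose i1 : 'I_(\rank (kermx M)) := Ordinal rank_ge2.
exists (form_of (row i0 B)), (form_of (row i1 B)); split=> //; try exact: form_of_homog.
move=> a b eq0.
have : (a *: delta_mx 0 i0 + b *: delta_mx 0 i1 : 'rV_(\rank (kermx M))) *m B = 0.
  rewrite mulmxDl -!scalemxAl -!rowE -(form_ofK (row i0 B)) -(form_ofK (row i1 B)).
  apply/rowP => j; have := congr1 (mcoeff (enum_val j : monom n d)) eq0.
  by rewrite mcoeffD !mcoeffZ mcoeff0 !mxE.
move/eqP; rewrite mulmx_free_eq0 ?row_base_free // => /eqP/rowP ab0.
split; first by have := ab0 i0; rewrite !mxE !eqxx /= mulr1 mulr0 addr0.
by have := ab0 i1; rewrite !mxE !eqxx /= mulr1 mulr0 add0r.
Qed.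

(* If q(F/G) vanished, then F/G would take only finitely many values, and so
   (F - a_1 G) ... (F - a_m G) G would vanish everywhere. *)
Lemma ratio_transcendental n (F G : {mpoly k[n]}) (q : {poly k}) :
    free_pair F G ->
    (forall v, G.@[v] != 0 -> q.[F.@[v] / G.@[v]] = 0) -> q = 0.
Proof.
move=> FG_free; have sub_neq0 a : F - a *: G != 0.
  apply/eqP => FaG0; have [] := FG_free 1 (- a); first by rewrite scale1r scaleNr.
  by move/eqP; rewrite oner_eq0.
have G_neq0 : G != 0.
  apply/eqP => G0; have [|_ /eqP] := FG_free 0 1; last by rewrite oner_eq0.
  by rewrite scale0r scale1r G0 addr0.
(* H collects the factors F - a G for the roots a already removed from q. *)
suff main (H : {mpoly k[n]}) : H != 0 ->
    (forall v, H.@[v] != 0 -> G.@[v] != 0 -> q.[F.@[v] / G.@[v]] = 0) -> q = 0.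
  by move=> q_FG; apply: (main 1) => [|v _]; [apply: oner_neq0 | apply: q_FG].
have [m] := ubnP (size q); elim: m q H => // m IHm q H /ltnSE le_qm H_neq0 q_FG.
have [v] := mpoly_nonroot k_char0 (mulf_neq0 H_neq0 G_neq0).
rewrite mevalM mulf_eq0 negb_or => /andP[Hv Gv].
set a := F.@[v] / G.@[v]; have /factor_theorem[q1 def_q] : root q a.
  by rewrite rootE q_FG.
have [q0|q_neq0] := eqVneq q 0; first by [].
have q1_neq0 : q1 != 0 by apply: contraNneq q_neq0 => q10; rewrite def_q q10 mul0r.
case/eqP: (q1_neq0); apply: (IHm _ (H * (F - a *: G))).
- by rewrite (leq_trans _ le_qm) // def_q size_Mmonic ?monicXsubC ?size_XsubC ?addn2 /=.
- by rewrite mulf_neq0.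
move=> w; rewrite mevalM mulf_eq0 negb_or => /andP[Hw FaGw] Gw.
have /eqP := q_FG w Hw Gw; rewrite def_q hornerM mulf_eq0 => /orP[/eqP//|].
rewrite !hornerE subr_eq0 => /eqP FGw; case/eqP: FaGw.
by rewrite mevalB mevalZ -FGw divfK ?subrr.
Qed.

(** Dividing a relation by G^(d-1) gives a polynomial relation for F/G. *)
Lemma pencil_powers_free n (F G : {mpoly k[n]}) d (c : 'I_d -> k) :
    free_pair F G ->
  \sum_(i < d) c i *: (F ^+ i * G ^+ (d.-1 - i)) = 0 -> forall i, c i = 0.
Proof.
move=> FG_free sum0.
pose q : {poly k} := \poly_(i < d) (oapp c 0 (insub i)).
have q0 : q = 0.
  apply: (ratio_transcendental FG_free) => v Gv.
  have /(congr1 (meval v)) := sum0; rewrite meval0 raddf_sum /= => sum0v.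
  apply/eqP; rewrite -(mulrI_eq0 _ (mulfI (expf_neq0 d.-1 Gv))) -[X in _ == X]sum0v.
  rewrite horner_poly mulr_sumr; apply/eqP/eq_bigr => i _.
  rewrite mevalZ mevalM !rmorphXn /= valK /= exprMn exprVn.
  have le_i : (i <= d.-1)%N by have := ltn_ord i; lia.
  rewrite -{1}(subnK le_i) exprD.
  by field; rewrite expf_neq0.
by move=> i; have := congr1 (fun q : {poly k} => q`_i) q0; rewrite coef_poly ltn_ord valK coef0.
Qed.

(* The nine points impose at most 54 conditions on the 56-dimensional space of
   cubics singular at them, whence a pencil F, G of such cubics; the products
   F^i G^(d-1-i) are forms of degree 3(d-1) vanishing to order 2(d-1). *)
Lemma power_mx_corank (L : 'M[k]_(9, 6)) d : (0 < d)%N ->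
  (d <= #|{: monom 6 (3 * (d - 1))}| - \rank (power_mx (3 * (d - 1)) (fun=> d) L))%N.
Proof.
move=> d_gt0; set D := (3 * (d - 1))%N; set A := power_mx _ _ _.
have [|F [G [F_homog G_homog FG_free F_perp G_perp]]] :=
  @exists_apolar_pair 6 3 ('I_9 * 'I_6)%type (fun x => lin (L x.1) ^+ 2 * 'X_(x.2)).
  by rewrite card_prod !card_ord card_monom.
have mult2 (H : {mpoly k[6]}) : H \is 3.-homog ->
    (forall x, apolar idfun 3 (lin (L x.1) ^+ 2 * 'X_(x.2)) H = 0) ->
    forall j, mult_at_least 2 (L j) H.
  move=> H_homog H_perp j; apply: (apolar_to_mult k_char0 H_homog (s := 2)) => m.
  rewrite -[3%N]/(1 + 2)%N => /addIn/eqP; rewrite mdeg_eq1 => /existsP[i /eqP->].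
  exact: (H_perp (j, i)).
have F_mult := mult2 F F_homog F_perp; have G_mult := mult2 G G_homog G_perp.
pose E (i : 'I_d) := F ^+ i * G ^+ (d.-1 - i).
have E_homog i : E i \is D.-homog.
  have -> : D = (3 * i + 3 * (d.-1 - i))%N by rewrite /D; have := ltn_ord i; lia.
  by rewrite dhomogM // dhomogMn.
have E_perp i j : apolar_to idfun D d (L j) (E i).
  apply: (mult_apolar_to k_char0 (E_homog i)) => v.
  (* The required order is 2(d - 1), of which F^i provides 2i. *)
  have -> : (D.+1 - d = 2 * i + 2 * (d.-1 - i))%N by rewrite /D; have := ltn_ord i; lia.
  by apply: mult_at_leastM; apply: mult_at_leastX.
(* The columns of W are the functionals dual to the E i; they are independent and killed by A, so
   rank A + d is at most the number of monomials. *)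
pose W : 'M[k]_(_, d) :=
  \matrix_(j, i) ((mfact (enum_val j : monom 6 D))%:R * coords D (E i) 0 j).
have AW0 : A *m W = 0.
  apply/matrixP => x i; rewrite !mxE.
  have := apolar_to_mul 'X_[(enum_val x).2] (E_perp i (enum_val x).1).
  rewrite apolarE => apolar0; rewrite -[RHS]apolar0; apply: eq_bigr => j _.
  by rewrite !mxE mulrCA mulrA.
have rankW : \rank W = d.
  rewrite -mxrank_tr; apply/eqP; rewrite -/(row_free _) -kermx_eq0.
  apply/negPn/negP => /rowV0Pn[c /sub_kermxP cW0 c_neq0]; case/eqP: c_neq0.
  apply/rowP => i; rewrite mxE; apply: (@pencil_powers_free _ F G d (c 0)) => //.
  apply: (@homog_eq 6 D) => [||m].
  - by apply: rpred_sum => j _; apply/rpredZ/E_homog.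
  - exact: dhomog0.
  have /rowP/(_ (enum_rank m)) := cW0; rewrite !mxE mcoeff0 raddf_sum => sum0.
  apply/eqP; rewrite -(mulrI_eq0 _ (mulfI (mfact_neq0 k_char0 m))) mulr_sumr -[X in _ == X]sum0.
  apply/eqP/eq_bigr => j _; rewrite !mxE enum_rankK /= mcoeffZ; ring.
by have := mulmx0_rank_max AW0; rewrite rankW; lia.
Qed.

End LowerBound.

(** * Degree and leading coefficient of the Hilbert series *)

Theorem proposition8p10 (k : fieldType) (k_char0 : [pchar k] =i pred0)
    (d : nat) (d_ge1 : (1 <= d)%N) :
  exists U : 'M[k]_(9, 6) -> Prop,
    [/\ zariski_open U,
        exists L, U L &
        forall L, U L ->
          exists H : {poly nat},
            [/\ is_hilbert_series (power_ideal d L) H,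
                size H = (3 * (d - 1)).+1%N &
                (d <= lead_coef H)%N]].
Proof.
(* U is the locus where the quotient vanishes in degree D = 3d - 2. *)
set D := (3 * (d - 1)).+1; pose U (L : 'M[k]_(9, 6)) := powers_span D (fun=> d) L.
exists U; split=> [||L span_L].
- exists (fun f => forall L : 'M[k]_(9, 6), f.@[fun i => mxvec L 0 i] != 0 -> U L) => L.
  split=> [/powers_span_open[f fL f_open]|[f f_open fL]]; last exact: f_open.
  by exists f.
(* The bound holds with equality: 9d = 3(3d - 2) + 6. *)
- apply: (exists_powers_span k_char0 (s := fun=> d)); right.
  by rewrite sum_nat_const card_ord /D; lia.
pose h i := (#|{: monom 6 i}| - \rank (power_mx i (fun=> d) L))%N.
have le_h : (d <= h (3 * (d - 1)))%N := power_mx_corank k_char0 L d_ge1.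
have size_H : size (\poly_(i < D) h i) = D.
  by apply: size_poly_eq; rewrite -lt0n; apply: leq_trans le_h.
exists (\poly_(i < D) h i); split=> // [i|]; last first.
  by rewrite /lead_coef size_H coef_poly ltnSn.
rewrite coef_poly; case: ltnP => [_|le_Di]; first exact: power_ideal_quot_dim.
(* From degree D on the empty family is a basis, since vanishing in degree D propagates upwards. *)
exists (fun=> 0); split=> [[]//|p p_homog]; exists 0; split=> [|c' _]; last first.
  by apply/rowP => -[].
rewrite big_ord0 subr0 power_idealE.
apply/(in_power_idealP (d := i)) => //; apply: submx_full.
apply/powers_spanP.
by elim: i le_Di {p p_homog} => // i IHi; rewrite leq_eqVlt => /orP[/eqP <-|/IHi/powers_span_succ].
Qed.
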